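(* Let $n$ be a positive integer, let $R$ be a finite commutative symmetric $\mathbb Z/n$-algebra with a fixed non-degenerate linear functional $\psi\colon R\to\mathbb Z/n$, and let $G_R(D)$ be a gcd-graph with $D=\{\mathcal I_1,\dots,\mathcal I_k\}$, where $\mathcal I_1,\dots,\mathcal I_k$ are distinct nonzero principal ideals and $\mathcal I_i=Rx_i$. Then the spectrum of $G_R(D)$ is the multiset $\{\lambda_g\}_{g\in R}$, where $$\lambda_g=\sum_{i=1}^k c(g,R/\operatorname{Ann}_R(x_i)),$$ and where the generalized Ramanujan sums are given explicitly by $$c(g,R/\operatorname{Ann}_R(x_i))=\frac{\varphi(R/\operatorname{Ann}_R(x_i))}{\varphi(R/\operatorname{Ann}_R(gx_i))}\,\mu(R/\operatorname{Ann}_R(gx_i)).$$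
   Context: All rings are finite, commutative, associative and unital. A finite $\mathbb Z/n$-algebra $R$ is symmetric if there is a $\mathbb Z/n$-linear map $\psi\colon R\to\mathbb Z/n$ whose kernel contains no nonzero ideal of $R$; such a $\psi$ is called a non-degenerate linear functional. For a set $D$ of nonzero principal ideals of $R$, the gcd-graph $G_R(D)$ has vertex set $R$, with $x,y$ adjacent if and only if $x-y\in S$, where $S=\{s\in R: Rs\in D\}$. The spectrum of a graph is the multiset of eigenvalues of its adjacency matrix. For $x\in R$, $\operatorname{Ann}_R(x)=\{a\in R: ax=0\}$. Fix a primitive $n$-th root of unity $\zeta_n\in\mathbb C$. For a finite symmetric $\mathbb Z/n$-algebra $R$ with non-degenerate functional $\psi$ and $g\in R$, the generalized Ramanujan sum is $c(g,R)=c_\psi(g,R)=\sum_{a\in R^\times}\zeta_n^{\psi(ga)}$. For $x\in R$ the algebra $R/\operatorname{Ann}_R(x)$ carries the non-degenerate functional $\psi_x(\bar a)=\psi(ax)$ (where $a$ is any lift of $\bar a$), and $c(g,R/\operatorname{Ann}_R(x))$ denotes the generalized Ramanujan sum of the image of $g$ in $R/\operatorname{Ann}_R(x)$ with respect to $\psi_x$, i.e. $\sum_{u\in (R/\operatorname{Ann}_R(x))^\times}\zeta_n^{\psi_x(gu)}$. For a finite ring $T$, $\varphi(T)=|T^\times|$. Writing $T\cong\prod_{i=1}^d T_i$ with $T_i$ local, $\mu(T)=1$ if $|T|=1$; $\mu(T)=0$ if some $T_i$ is not a field; and $\mu(T)=(-1)^d$ otherwise. *)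

(* Defs.v *)
From HB Require Import structures.
From Stdlib Require Import ClassicalEpsilon.
From mathcomp Require Import all_boot all_order all_algebra.
From mathcomp Require Import generic_quotient ring_quotient.
From mathcomp Require Import complex reals.

Set Implicit Arguments.
Unset Strict Implicit.
Unset Printing Implicit Defensive.
Set Warnings "-redundant-canonical-projection".
Import GRing.Theory.
Local Open Scope ring_scope.
Local Open Scope quotient_scope.

(* The ring Z/n. Unlike 'Z_n, which is Z/2 for n = 1, this is the zero ring   *)
(* for n = 1; hence only a possibly-zero ring ("Pz") structure. The value at  *)
(* n = 0 is junk: statements about Zmod n assume 0 < n.                       *)
Definition Zmod (n : nat) : Type := 'I_n.-1.+1.

HB.instance Definition _ n := Finite.on (Zmod n).
HB.instance Definition _ n := GRing.Zmodule.on (Zmod n).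
HB.instance Definition _ n := GRing.Zmodule_isComPzRing.Build (Zmod n)
  (@Zp_mulA n.-1.+1) (@Zp_mulC n.-1.+1) (@Zp_mul1z n.-1) (@Zp_mul_addl n.-1.+1).

(* The representative of c in {0, ..., n - 1}. *)
Definition Zmod_val n (c : Zmod n) : nat := nat_of_ord (c : 'I_n.-1.+1).

(* A finite commutative unital Z/n-algebra is a finite commutative ring with  *)
(* a ring morphism from Z/n (its structure map). MathComp's own finite module *)
(* and algebra structures require nonzero rings, so that they apply neither   *)
(* to the base ring Zmod 1 nor to the zero algebra, both allowed here.        *)
HB.mixin Record isZmodAlgebra (n : nat) A of FinRing.ComPzRing A := {
  Zmod_in_alg : {rmorphism Zmod n -> A}
}.

#[short(type="finZmodAlgType")]
HB.structure Definition FinZmodAlgebra (n : nat) :=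
  {A of FinRing.ComPzRing A & isZmodAlgebra n A}.

Definition Zmod_scale n (A : finZmodAlgType n) (c : Zmod n) (x : A) : A :=
  Zmod_in_alg c * x.

Definition Zmod_linear n (A : finZmodAlgType n) (psi : A -> Zmod n) : Prop :=
  forall (c : Zmod n) (x y : A),
    psi (Zmod_scale c x + y) = c * psi x + psi y.

Section Rings.
Variable T : finComPzRingType.
Implicit Types (x : T) (I M : {set T}).

(* The library's idealr_closed is not used: it only covers proper ideals. *)
Definition is_ideal I : bool :=
  [&& 0 \in I, [forall x in I, forall y in I, x + y \in I]
    & [forall a : T, forall x in I, a * x \in I]].

Definition principal_ideal x : {set T} := [set a * x | a : T].

Definition ring_unit x : bool := [exists y, y * x == 1].

Definition phi : nat := #|[set x | ring_unit x]|.

Definition maximal_ideal M : bool :=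
  maxset (fun I => is_ideal I && (I != [set: T])) M.

Definition is_local : Prop := exists! M, maximal_ideal M.

Definition is_field : bool :=
  (1 != 0 :> T) && [forall x, (x != 0) ==> ring_unit x].

End Rings.

Arguments phi : clear implicits.
Arguments is_local : clear implicits.
Arguments is_field : clear implicits.

(* A family of ring morphisms T -> T_ i is the same thing as a ring morphism  *)
(* from T to the product of the T_ i; the last condition says that the latter *)
(* is bijective.                                                              *)
Definition local_decomposition (T : finComPzRingType) (d : nat)
    (T_ : 'I_d -> finComPzRingType) (f : forall i, {rmorphism T -> T_ i}) :=
  (forall i, is_local (T_ i)) /\
  (forall y : forall i, T_ i, exists! x : T, forall i, f i x = y i).

Definition is_mobius (T : finComPzRingType) (m : int) : Prop :=
  exists (d : nat) (T_ : 'I_d -> finComPzRingType)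
         (f : forall i, {rmorphism T -> T_ i}),
    local_decomposition f /\
    m = if #|T| == 1%N then 1
        else if [exists i, ~~ is_field (T_ i)] then 0
        else (-1) ^+ d.

(* A finite ring has an essentially unique decomposition into local rings, so *)
(* is_mobius T holds of exactly one integer, which epsilon selects.           *)
Definition mobius (T : finComPzRingType) : int :=
  epsilon (inhabits (0 : int)) (is_mobius T).

Definition nondegenerate_functional n (T : finZmodAlgType n)
    (psi : T -> Zmod n) : Prop :=
  Zmod_linear psi /\
  forall I : {set T}, is_ideal I -> {in I, forall a, psi a = 0} -> I = [set 0].

Section QuotientByAnnihilator.
Variables (n : nat) (R : finZmodAlgType n) (x : R).

Definition Ann : {pred R} := fun a => a * x == 0.

Lemma AnnE a : (a \in Ann) = (a * x == 0). Proof. by []. Qed.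

Lemma Ann_zmod_closed : zmod_closed Ann.
Proof.
split=> [|a b]; first by rewrite AnnE mul0r.
by rewrite !AnnE mulrBl => /eqP-> /eqP->; rewrite subrr.
Qed.

HB.instance Definition _ := GRing.isZmodClosed.Build R Ann Ann_zmod_closed.

Definition quotAnn : Type := {ideal_quot Ann}.

HB.instance Definition _ := GRing.Zmodule.on quotAnn.
HB.instance Definition _ := EqQuotient.on quotAnn.
HB.instance Definition _ : isCountable quotAnn :=
  CanIsCountable (@reprK R quotAnn).
HB.instance Definition _ : isFinite quotAnn := CanIsFinite (@reprK R quotAnn).

Definition quotAnn_pi (a : R) : quotAnn := \pi_quotAnn a.

Lemma quotAnn_piP a b : reflect (a * x = b * x) (quotAnn_pi a == quotAnn_pi b).
Proof.
rewrite /quotAnn_pi -Quotient.idealrBE AnnE mulrBl subr_eq0; exact: eqP.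
Qed.

Lemma quotAnn_repr (u : quotAnn) : quotAnn_pi (repr u) = u.
Proof. exact: reprK. Qed.

Lemma repr_quotAnn_pi a : repr (quotAnn_pi a) * x = a * x.
Proof. by apply/quotAnn_piP; rewrite quotAnn_repr. Qed.

Lemma quotAnn_piD a b : quotAnn_pi (a + b) = quotAnn_pi a + quotAnn_pi b.
Proof. exact: Quotient.pi_add. Qed.

Lemma quotAnn_pi0 : quotAnn_pi 0 = 0.
Proof. by apply: (addIr (quotAnn_pi 0)); rewrite -quotAnn_piD !add0r. Qed.

Lemma quotAnn_surj (u : quotAnn) : {a | u = quotAnn_pi a}.
Proof. by exists (repr u); rewrite quotAnn_repr. Qed.

Definition quotAnn_one : quotAnn := quotAnn_pi 1.
Definition quotAnn_mul (u v : quotAnn) : quotAnn :=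
  quotAnn_pi (repr u * repr v).

Lemma quotAnn_mulE a b :
  quotAnn_mul (quotAnn_pi a) (quotAnn_pi b) = quotAnn_pi (a * b).
Proof.
apply/eqP/quotAnn_piP.
by rewrite -mulrA repr_quotAnn_pi mulrCA repr_quotAnn_pi mulrCA mulrA.
Qed.

Lemma quotAnn_mulA : associative quotAnn_mul.
Proof.
move=> u v w; have [[a ->] [b ->]] := (quotAnn_surj u, quotAnn_surj v).
by have [c ->] := quotAnn_surj w; rewrite !quotAnn_mulE mulrA.
Qed.

Lemma quotAnn_mulC : commutative quotAnn_mul.
Proof. by move=> u v; rewrite /quotAnn_mul mulrC. Qed.

Lemma quotAnn_mul1 : left_id quotAnn_one quotAnn_mul.
Proof.
by move=> u; have [a ->] := quotAnn_surj u; rewrite quotAnn_mulE mul1r.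
Qed.

Lemma quotAnn_mulDl : left_distributive quotAnn_mul +%R.
Proof.
move=> u v w; have [[a ->] [b ->]] := (quotAnn_surj u, quotAnn_surj v).
have [c ->] := quotAnn_surj w.
by rewrite -quotAnn_piD !quotAnn_mulE mulrDl quotAnn_piD.
Qed.

HB.instance Definition _ := GRing.Zmodule_isComPzRing.Build quotAnn
  quotAnn_mulA quotAnn_mulC quotAnn_mul1 quotAnn_mulDl.

Lemma quotAnn_piM a b : quotAnn_pi (a * b) = quotAnn_pi a * quotAnn_pi b.
Proof. by rewrite -quotAnn_mulE. Qed.

Definition quotAnn_in_alg (c : Zmod n) : quotAnn := quotAnn_pi (Zmod_in_alg c).

Lemma quotAnn_in_alg_zmod_morphism : zmod_morphism quotAnn_in_alg.
Proof.
move=> c d; apply: (addIr (quotAnn_in_alg d)).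
by rewrite subrK /quotAnn_in_alg -quotAnn_piD rmorphB subrK.
Qed.

Lemma quotAnn_in_alg_monoid_morphism : monoid_morphism quotAnn_in_alg.
Proof.
by split=> [|c d]; rewrite /quotAnn_in_alg ?rmorph1 // rmorphM quotAnn_piM.
Qed.

HB.instance Definition _ := GRing.isZmodMorphism.Build (Zmod n) quotAnn
  quotAnn_in_alg quotAnn_in_alg_zmod_morphism.
HB.instance Definition _ := GRing.isMonoidMorphism.Build (Zmod n) quotAnn
  quotAnn_in_alg quotAnn_in_alg_monoid_morphism.
HB.instance Definition _ := isZmodAlgebra.Build n quotAnn quotAnn_in_alg.

Variable psi : R -> Zmod n.

Definition quotAnn_psi (u : quotAnn) : Zmod n := psi (repr u * x).

Lemma quotAnn_psiE a : quotAnn_psi (quotAnn_pi a) = psi (a * x).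
Proof. by rewrite /quotAnn_psi repr_quotAnn_pi. Qed.

Lemma quotAnn_psi_linear : Zmod_linear psi -> Zmod_linear quotAnn_psi.
Proof.
move=> lin c u v; have [[a ->] [b ->]] := (quotAnn_surj u, quotAnn_surj v).
have -> : Zmod_scale c (quotAnn_pi a) = quotAnn_pi (Zmod_scale c a).
  by rewrite quotAnn_piM.
rewrite -quotAnn_piD !quotAnn_psiE mulrDl -mulrA; exact: lin.
Qed.

End QuotientByAnnihilator.

Lemma quotAnn_psi_nondegenerate n (R : finZmodAlgType n) (psi : R -> Zmod n)
    (x : R) :
  nondegenerate_functional psi ->
  nondegenerate_functional (quotAnn_psi (x := x) psi).
Proof.
case=> lin nd; split=> [|I]; first exact: quotAnn_psi_linear.
case/and3P=> I0 /forall_inP ID /forallP IM Ipsi.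
apply/setP=> u; change (quotAnn x) in u; rewrite inE; apply/idP/eqP=> [uI|->//].
pose J : {set R} := [set repr (v : quotAnn x) * x | v : quotAnn x in I].
have JE a : quotAnn_pi x a \in I -> a * x \in J.
  by move=> aI; apply/imsetP; exists (quotAnn_pi x a); rewrite ?repr_quotAnn_pi.
have J0 : J = [set 0].
  apply: nd; last by move=> _ /imsetP[v vI ->]; exact: Ipsi.
  apply/and3P; split.
  - by rewrite -(mul0r x); apply: JE; rewrite quotAnn_pi0.
  - apply/forall_inP=> _ /imsetP[v vI ->]; apply/forall_inP=> _ /imsetP[w wI ->].
    rewrite -mulrDl; apply: JE; rewrite quotAnn_piD !quotAnn_repr.
    exact: (forall_inP (ID v vI) w wI).
  - apply/forallP=> a; apply/forall_inP=> _ /imsetP[v vI ->].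
    rewrite mulrA; apply: JE; rewrite quotAnn_piM quotAnn_repr.
    exact: (forall_inP (IM (quotAnn_pi x a)) v vI).
have : repr u * x \in J by apply/imsetP; exists u.
rewrite J0 inE => /eqP ux0; rewrite -(quotAnn_repr u).
by rewrite -[RHS]quotAnn_pi0; apply/eqP/quotAnn_piP; rewrite ux0 mul0r.
Qed.

Definition ramanujan_sum (C : closedFieldType) (zeta : C) n
    (T : finZmodAlgType n) (psi : T -> Zmod n) (g : T) : C :=
  \sum_(a : T | ring_unit a) zeta ^+ Zmod_val (psi (g * a)).

(* c(g, R / Ann(x)), with respect to psi_x. *)
Definition ramanujan_sum_quotAnn (C : closedFieldType) (zeta : C) n
    (R : finZmodAlgType n) (psi : R -> Zmod n) (g x : R) : C :=
  ramanujan_sum zeta (quotAnn_psi (x := x) psi) (quotAnn_pi x g).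

Definition gcd_graph (R : finComPzRingType) (D : {set {set R}}) : rel R :=
  fun x y => principal_ideal (x - y) \in D.

Definition adjacency_mx (C : closedFieldType) (V : finType) (e : rel V) :
    'M[C]_#|V| :=
  \matrix_(i, j) (e (enum_val i) (enum_val j))%:R.

(* The eigenvalues with multiplicity, i.e. the roots of the characteristic    *)
(* polynomial; the order is arbitrary, so compare spectra up to perm_eq.      *)
Definition spectrum (C : closedFieldType) m (A : 'M[C]_m) : seq C :=
  sval (closed_field_poly_normal (char_poly A)).

(* Main.v *)
(* The characters a |-> zeta ^ psi (g * a) diagonalise the adjacency matrix of *)
(* the Cayley graph, and the generators of R x are the multiples of x by the   *)
(* units of R / Ann x, so the eigenvalues are sums of Ramanujan sums.          *)
(* Units lift along the surjection R / Ann x -> R / Ann (g * x) with fibres of *)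
(* constant size, which reduces the explicit formula to the evaluation of      *)
(* sum_{u unit} chi u for a character chi that is nontrivial on every nonzero  *)
(* ideal. By inclusion-exclusion over the maximal ideals this is a signed      *)
(* count of the sets of maximal ideals with zero intersection: only the full   *)
(* set can contribute, and does so exactly when all the local factors are      *)
(* fields, hence the Moebius function. The local decomposition of the algebra  *)
(* T that defines the latter exists because 1 is the sum of the primitive      *)
(* idempotents e of T, which are orthogonal and have local quotients T / Ann e.*)

From HB Require Import structures.
Require Import Defs.
From Stdlib Require Import ClassicalEpsilon.
From mathcomp Require Import all_boot all_order all_algebra.
From mathcomp Require Import generic_quotient complex reals.

Set Implicit Arguments.
Unset Strict Implicit.
Unset Printing Implicit Defensive.
Import GRing.Theory.
Local Open Scope ring_scope.

(** Both halves rest on the additive character [chi a = zeta ^+ Zmod_val (psi a)], which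
    nondegeneracy of [psi] makes nontrivial on every nonzero ideal ([functional_character]).
    Spectrum: adjacency is invariant under translation, so each function sending a to chi(ga) is an
    eigenvector, with eigenvalue the sum of chi(gs) over the generators s of members of D;
    orthogonality makes these functions a basis ([gcd_graph_spectrum]). The generators of Rx
    contribute a sum over the units of R/Ann(x), a Ramanujan sum ([sum_principal_generators]).
    Formula: psi(gax) depends only on a modulo Ann(gx), so [sum_units_surj] moves the sum to
    R/Ann(gx) at the cost of a ratio of [phi] values. There [mobius_unit_sum] evaluates it,
    [exists_mobius] supplying the local decomposition. *)

(** * Finite rings: idempotent powers, ideals, units, locality *)

(** By the pigeonhole principle the powers of [a] are eventually periodic; take for N a multiple of
    the period beyond the preperiod. *)
Lemma exists_idempotent_power (T : finPzRingType) (a : T) :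
  exists2 N, (0 < N)%N & a ^+ N * a ^+ N = a ^+ N.
Proof.
pose h (i : 'I_#|T|.+1) := a ^+ i.
have /injectivePn[i [j neq_ij eq_h]] : ~~ injectiveb h.
  by apply/injectiveP=> /leq_card; rewrite card_ord ltnn.
wlog lt_ij : i j neq_ij eq_h / (i < j)%N.
  move=> hw; case: (ltngtP i j) => [|lt_ji|/val_inj eq_ij]; first exact: hw.
    by apply: (hw j i) => //; rewrite eq_sym.
  by rewrite eq_ij eqxx in neq_ij.
pose p := (j - i)%N.
have p_gt0 : (0 < p)%N by rewrite subn_gt0.
have period m : (i <= m)%N -> a ^+ (m + p) = a ^+ m.
  move=> le_im; rewrite -[in LHS](subnKC le_im) addnAC exprD subnKC 1?ltnW //.
  by rewrite -[a ^+ j]eq_h -exprD subnKC.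
have periods k m : (i <= m)%N -> a ^+ (m + k * p) = a ^+ m.
  move=> le_im; elim: k => [|k IHk]; first by rewrite mul0n addn0.
  by rewrite mulSnr addnA period // (leq_trans le_im) ?leq_addr.
(* The factor [i.+1] keeps this multiple of [p] positive even when [i] is 0. *)
exists (i.+1 * p)%N; first by rewrite muln_gt0.
by rewrite -exprD periods // (leq_trans (leqnSn i)) // leq_pmulr.
Qed.

Section Units.
Variable T : finComPzRingType.
Implicit Types (x y : T) (I : {set T}).

Lemma is_idealP I :
  reflect [/\ 0 \in I, {in I &, forall x y, x + y \in I}
             & forall a, {in I, forall x, a * x \in I}]
          (is_ideal I).
Proof.
apply: (iffP and3P) => [] [I0 ID IM]; split=> //.
- by move=> x y xI yI; exact: (forall_inP (forall_inP ID x xI) y yI).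
- by move=> a x xI; exact: (forall_inP (forallP IM a) x xI).
- by apply/forall_inP=> x xI; apply/forall_inP=> y yI; exact: ID.
- by apply/forallP=> a; apply/forall_inP=> x xI; exact: IM.
Qed.

Lemma ring_unitP x : reflect (exists y, y * x = 1) (ring_unit x).
Proof. by apply: (iffP existsP) => [] [y yx]; exists y; apply/eqP. Qed.

Lemma ring_unit1 : ring_unit (1 : T).
Proof. by apply/ring_unitP; exists 1; rewrite mulr1. Qed.

Lemma ring_unitM x y : ring_unit (x * y) = ring_unit x && ring_unit y.
Proof.
apply/ring_unitP/andP=> [[z zxy]|[/ring_unitP[x' x'x] /ring_unitP[y' y'y]]].
  split; apply/ring_unitP; first by exists (z * y); rewrite mulrAC -mulrA.
  by exists (z * x); rewrite -mulrA.
by exists (x' * y'); rewrite mulrACA x'x y'y mulr1.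
Qed.

Lemma mulr_unit_inj x : ring_unit x -> injective ( *%R x).
Proof.
by case/ring_unitP=> y yx a b /(congr1 ( *%R y)); rewrite !mulrA yx !mul1r.
Qed.

Lemma ideal_unit I x : is_ideal I -> x \in I -> ring_unit x -> I = [set: T].
Proof.
case/is_idealP=> _ _ IM xI /ring_unitP[y yx]; apply/setP=> a.
by rewrite inE -[a]mulr1 -yx mulrA IM.
Qed.

Lemma principal_ideal_is_ideal x : is_ideal (principal_ideal x).
Proof.
apply/is_idealP; split.
- by apply/imsetP; exists 0; rewrite ?mul0r.
- move=> _ _ /imsetP[a _ ->] /imsetP[b _ ->].
  by apply/imsetP; exists (a + b); rewrite ?mulrDl.
- by move=> a _ /imsetP[b _ ->]; apply/imsetP; exists (a * b); rewrite ?mulrA.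
Qed.

Lemma mem_principal_ideal x : x \in principal_ideal x.
Proof. by apply/imsetP; exists 1; rewrite ?mul1r. Qed.

Definition nonunits : {set T} := [set x | ~~ ring_unit x].

(** A nonunit generates a proper ideal, which lies in a maximal one; conversely proper ideals
    contain no units. Both sides fail for the zero ring, where 0 is a unit. *)
Lemma is_localE : is_local T <-> is_ideal nonunits.
Proof.
split=> [[M [maxM uniqM]]|idN]; last first.
  have maxN (J : {set T}) : is_ideal J && (J != setT) -> J \subset nonunits.
    case/andP=> idJ neqJ; apply/subsetP=> x xJ; rewrite inE.
    by apply: contra neqJ => /(ideal_unit idJ xJ)->.
  have idNT : is_ideal nonunits && (nonunits != setT).
    rewrite idN; apply/eqP=> /setP/(_ 1).
    by rewrite !inE ring_unit1.
  exists nonunits; split=> [|J /maxsetP[/maxN NJ maxJ]].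
    apply/maxsetP; split=> // J /maxN JN NJ.
    by apply/eqP; rewrite eqEsubset JN.
  exact: maxJ.
have [/andP[idM neqM] _] := maxsetP maxM.
suff -> : nonunits = M by [].
apply/setP=> x; rewrite inE; apply/idP/idP=> [nUx|xM]; last first.
  by apply: contra neqM => /(ideal_unit idM xM)->.
have [|J maxJ xJ] := @maxset_exists _
    (fun I => is_ideal I && (I != [set: T])) (principal_ideal x).
  rewrite principal_ideal_is_ideal; apply: contraNneq nUx => /setP/(_ 1).
  rewrite inE => /imsetP[y _ y1]; apply/ring_unitP; exists y.
  exact: esym y1.
rewrite (uniqM J maxJ); exact: (subsetP xJ) (mem_principal_ideal x).
Qed.

Lemma is_fieldE : is_ideal nonunits -> is_field T = (nonunits == [set 0]).
Proof.
case/is_idealP=> N0 _ _; apply/andP/eqP=> [[_ /forallP Tf]|NE].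
  apply/setP=> x; rewrite in_set1; apply/idP/eqP=> [|-> //].
  by apply: contraTeq => x0; rewrite inE negbK (implyP (Tf x)).
split; first by rewrite -in_set1 -NE inE ring_unit1.
apply/forallP=> x; apply/implyP=> x0.
by apply: contraR x0 => nUx; rewrite -in_set1 -NE inE.
Qed.

End Units.

Arguments nonunits : clear implicits.

(** * Lifting units along surjective morphisms *)

Lemma rmorph_ring_unit (T S : finComPzRingType) (f : {rmorphism T -> S}) x :
  ring_unit x -> ring_unit (f x).
Proof.
by case/ring_unitP=> y yx; apply/ring_unitP; exists (f y); rewrite -rmorphM yx rmorph1.
Qed.

(* If e = a ^+ N is idempotent, then a * e + (1 - e) is a unit, and it has the *)
(* same image as a because e is mapped to an idempotent unit, that is, to 1.  *)
Lemma unit_lift (T S : finComPzRingType) (f : {rmorphism T -> S}) (v : S) :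
  (forall w, exists a, f a = w) -> ring_unit v ->
  exists2 u, ring_unit u & f u = v.
Proof.
move=> f_surj Uv; have [a fa] := f_surj v.
have [[//|N] _ idem] := exists_idempotent_power a.
set e := a ^+ N.+1 in idem.
have fe : f e = 1.
  have Ue : ring_unit (f e).
    rewrite rmorphXn fa; elim: (N.+1) => [|m IHm]; first by rewrite expr0 ring_unit1.
    by rewrite exprS ring_unitM Uv.
  by apply: (mulr_unit_inj Ue); rewrite -rmorphM idem mulr1.
exists (a * e + (1 - e)); last first.
  by rewrite rmorphD rmorphB rmorphM fe rmorph1 subrr addr0 mulr1.
apply/ring_unitP; exists (a ^+ N * e + (1 - e)).
set d := 1 - e.
have ed : e * d = 0 by rewrite mulrBr mulr1 idem subrr.
have dd : d * d = d by rewrite {1}/d mulrBl mul1r ed subr0.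
have eD1 : e + d = 1 by rewrite addrC subrK.
clearbody d; rewrite mulrDr !mulrDl mulrACA -exprSr -/e !idem.
rewrite -[a ^+ N * e * _]mulrA ed mulr0 add0r.
by rewrite [d * (a * e)]mulrCA [d * e]mulrC ed mulr0 addr0 dd.
Qed.

(** Multiplication by a unit lift of v carries the units above 1 onto the units above v, so all
    fibres have the same size. Cross-multiplying by [phi] avoids division in [C]. *)
Lemma sum_units_surj (C : pzRingType) (T S : finComPzRingType)
    (f : {rmorphism T -> S}) (F : S -> C) :
  (forall w, exists a, f a = w) ->
  (phi S)%:R * \sum_(u : T | ring_unit u) F (f u) =
  (phi T)%:R * \sum_(v : S | ring_unit v) F v.
Proof.
move=> f_surj.
pose fibre v := [set u : T | ring_unit u & f u == v].
have card_fibre v : ring_unit v -> #|fibre v| = #|fibre 1|.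
  move=> /(unit_lift f_surj)[u Uu fu].
  rewrite -(card_imset (mem (fibre 1)) (mulr_unit_inj Uu)); apply: eq_card => w.
  apply/idP/imsetP=> [|[z + ->]]; rewrite !inE; last first.
    by rewrite ring_unitM Uu rmorphM fu => /andP[-> /eqP->]; rewrite mulr1 eqxx.
  case/andP=> Uw /eqP fw; have /ring_unitP[u' u'u] := Uu.
  exists (u' * w); last by rewrite mulrA [u * _]mulrC u'u mul1r.
  have Uu' : ring_unit u' by apply/ring_unitP; exists u; rewrite mulrC.
  by rewrite inE ring_unitM Uu' Uw rmorphM fw -fu -rmorphM u'u rmorph1 eqxx.
have sumE (G : S -> C) :
    \sum_(u : T | ring_unit u) G (f u) =
    #|fibre 1|%:R * \sum_(v : S | ring_unit v) G v.
  rewrite (partition_big f (fun v => ring_unit v)) => [|u]; last first.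
    exact: rmorph_ring_unit.
  rewrite mulr_sumr; apply: eq_bigr => v Uv.
  rewrite (eq_bigr (fun=> G v)) => [|u /andP[_ /eqP-> //]].
  rewrite sumr_const -(card_fibre v Uv) mulr_natl; congr (_ *+ _).
  by apply: eq_card => u; rewrite !inE.
have -> : (phi T)%:R = #|fibre 1|%:R * (phi S)%:R :> C.
  by have := sumE (fun=> 1); rewrite !sumr_const /phi !cardsE.
by rewrite sumE mulrA (mulr_natl _ (phi S)) (mulr_natr _ (phi S)).
Qed.

(** * Characters nontrivial on nonzero ideals *)

Section Characters.
Variables (C : fieldType) (T : finComPzRingType).

(** Known as a generating character of the ring. *)
Definition nondegenerate_character (chi : T -> C) : Prop :=
  [/\ chi 0 = 1, {morph chi : a b / a + b >-> a * b}
    & forall I : {set T}, is_ideal I -> {in I, forall a, chi a = 1} ->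
        I = [set 0]].

Variable chi : T -> C.
Hypothesis chi_nd : nondegenerate_character chi.

(** If [chi b != 1] for some b in [I], translation by b multiplies the sum by [chi b] and leaves it
    unchanged, so it vanishes. *)
Lemma character_sum_ideal (I : {set T}) :
  is_ideal I -> \sum_(a in I) chi a = (I == [set 0])%:R.
Proof.
case: chi_nd => chi0 chiD nd idI; have /is_idealP[I0 ID IM] := idI.
have [-> | neqI] := eqVneq I [set 0]; first by rewrite big_set1 chi0.
have [b bI chib] : exists2 b, b \in I & chi b != 1.
  apply/exists_inP; apply: contraR neqI => /exists_inPn chiI.
  by apply/eqP/nd=> // a aI; apply/eqP; rewrite -[_ == _]negbK chiI.
apply/eqP; rewrite -(mulrI_eq0 _ (mulfI _ : GRing.lreg (chi b - 1))) ?subr_eq0 //.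
rewrite mulrBl mul1r subr_eq0 mulr_sumr; apply/eqP.
rewrite [RHS](reindex_inj (addrI b)); apply: eq_big => [a|a _]; last first.
  by rewrite chiD.
apply/idP/idP=> [aI|baI]; first exact: ID.
by rewrite -[a](addKr b) ID // -mulN1r IM.
Qed.

(** Orthogonality: for nonzero [g], [chi] is nontrivial on the ideal generated by [g], and the
    translation argument applies again. *)
Lemma character_sum (g : T) : \sum_a chi (g * a) = #|T|%:R * (g == 0)%:R.
Proof.
case: chi_nd => chi0 chiD nd.
have [-> | g0] := eqVneq g 0.
  rewrite mulr1 (eq_bigr (fun=> 1)) ?sumr_const // => a _.
  by rewrite mul0r chi0.
have [b chib] : exists b, chi (g * b) != 1.
  apply/existsP; apply: contraR g0 => /existsPn chiI.
  rewrite -in_set1 -(nd _ (principal_ideal_is_ideal g)).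
    exact: mem_principal_ideal.
  by move=> _ /imsetP[a _ ->]; apply/eqP; rewrite mulrC -[_ == _]negbK chiI.
apply/eqP; rewrite mulr0 -(mulrI_eq0 _ (mulfI _ : GRing.lreg (chi (g * b) - 1)))
  ?subr_eq0 //.
rewrite mulrBl mul1r subr_eq0 mulr_sumr; apply/eqP.
rewrite [RHS](reindex_inj (addrI b)); apply: eq_bigr => a _.
by rewrite mulrDr chiD.
Qed.

End Characters.

(** * Unit sums in products of local rings *)

Section LocalDecomposition.
Variables (T : finComPzRingType) (d : nat) (T_ : 'I_d -> finComPzRingType).
Variable f : forall i, {rmorphism T -> T_ i}.
Hypothesis f_dec : local_decomposition f.

Lemma local_decomposition_inj x y : (forall i, f i x = f i y) -> x = y.
Proof.
case: f_dec => _ /(_ (fun i => f i y))[z [_ uniqz]] eq_f.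
by rewrite -(uniqz x) ?(uniqz y).
Qed.

Lemma local_decomposition_single i (y : T_ i) :
  exists2 x, f i x = y & forall j, j != i -> f j x = 0.
Proof.
case: f_dec => _ /(_ (dfwith (fun j => 0 : T_ j) y))[x [fx _]].
exists x => [|j neq_ji]; first by rewrite fx dfwith_in.
by rewrite fx dfwith_out // eq_sym.
Qed.

Lemma local_decomposition_unit x :
  ring_unit x = [forall i, ring_unit (f i x)].
Proof.
apply/idP/forallP=> [Ux i|Ufx]; first exact: rmorph_ring_unit.
case: f_dec => _ /(_ (fun i => xchoose (existsP (Ufx i))))[z [fz _]].
apply/ring_unitP; exists z; apply: local_decomposition_inj => i.
by rewrite rmorphM rmorph1 fz; apply/eqP; exact: (xchooseP (existsP (Ufx i))).
Qed.

(** The intersection of the maximal ideals attached to the indices in [J]; all of [T] when [J] is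
    empty. *)
Let I_ (J : {set 'I_d}) : {set T} :=
  [set x | [forall i in J, f i x \in nonunits (T_ i)]].

Let idN i : is_ideal (nonunits (T_ i)).
Proof. by apply/is_localE; case: f_dec. Qed.

Lemma local_decomposition_ideal J : is_ideal (I_ J).
Proof.
apply/is_idealP; split.
- rewrite inE; apply/forall_inP=> i _; rewrite rmorph0.
  by case/is_idealP: (idN i).
- move=> x y; rewrite !inE => /forall_inP xI /forall_inP yI.
  apply/forall_inP=> i iJ; rewrite rmorphD.
  by case/is_idealP: (idN i) => _ + _; apply; [exact: xI | exact: yI].
- move=> a x; rewrite !inE => /forall_inP xI; apply/forall_inP=> i iJ.
  by rewrite rmorphM; case/is_idealP: (idN i) => _ _; apply; exact: xI.
Qed.

(** An element supported at a single index i lies in [I_ J] once i is outside [J] or its coordinate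
    is a nonunit. If [I_ J] is zero, nonunit coordinates must therefore vanish, and the coordinate 1
    excludes any i outside [J]. *)
Lemma local_decomposition_ideal0 J :
  (I_ J == [set 0]) = [forall i, is_field (T_ i)] && (J == setT).
Proof.
apply/eqP/andP=> [I0|[/forallP Ff /eqP->]]; last first.
  apply/setP=> x; rewrite in_set1 inE; apply/forall_inP/eqP=> [fx|-> i _].
    apply: local_decomposition_inj => i; apply/eqP; rewrite rmorph0 -in_set1.
    have /eqP <- : nonunits (T_ i) == [set 0] by rewrite -is_fieldE.
    exact: fx.
  by rewrite rmorph0; case/is_idealP: (idN i).
have single0 i (y : T_ i) : (i \in J -> y \in nonunits (T_ i)) -> y = 0.
  have [x fix_ fjx] := local_decomposition_single y => yN.
  suff : x \in I_ J by rewrite I0 inE -fix_ => /eqP->; rewrite rmorph0.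
  rewrite inE; apply/forall_inP=> j jJ.
  have [eq_ji | /fjx ->] := eqVneq j i; last by case/is_idealP: (idN j).
  by rewrite eq_ji fix_ yN // -eq_ji.
split.
  apply/forallP=> i; rewrite is_fieldE //; apply/eqP/setP=> y.
  rewrite in_set1; apply/idP/eqP=> [yN|->]; first exact: single0.
  by case/is_idealP: (idN i).
apply/eqP/setP=> i; rewrite inE; apply: contraT => iJ.
have := idN i; case/is_idealP; rewrite -(single0 i 1) => [|/(negP iJ) //].
by rewrite inE ring_unit1.
Qed.

(* Expand the indicator prod_i (1 - [f_i x is a nonunit]) of the units over the *)
(* subsets J of indices: the J-th term is a character sum over an ideal.       *)
Lemma character_sum_units (C : fieldType) (chi : T -> C) :
  nondegenerate_character chi ->
  \sum_(u : T | ring_unit u) chi u =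
  if [exists i, ~~ is_field (T_ i)] then 0 else (-1) ^+ d.
Proof.
move=> chi_nd.
have unitE x : (ring_unit x)%:R =
    \sum_(J : {set 'I_d}) (-1) ^+ #|J| * (x \in I_ J)%:R :> C.
  transitivity (\prod_(i < d) (- (f i x \in nonunits (T_ i))%:R + 1) : C).
    rewrite local_decomposition_unit.
    case: (boolP [forall i, _]) => [/forallP Ux|/forallPn[i nUx]].
      by rewrite big1 // => i _; rewrite inE Ux oppr0 add0r.
    by rewrite (bigD1 i) //= inE nUx addNr mul0r.
  rewrite bigA_distr; apply: eq_bigr => J _.
  rewrite -big_mkcond prodrN -sum1_card sum1_card; congr (_ * _).
  rewrite inE; case: (boolP [forall i in J, _]) => [/forall_inP xJ|].
    by rewrite big1 // => i /xJ->.
  case/forall_inPn=> i iJ /negbTE nxN.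
  by rewrite (bigD1 i) //= nxN mul0r.
under eq_bigl do rewrite -[ring_unit _]andTb.
rewrite big_mkcondr.
under eq_bigr => x _ do rewrite -[if _ then _ else _]mulrb -mulr_natr unitE mulr_sumr.
rewrite exchange_big /=.
transitivity (\sum_(J : {set 'I_d}) (-1) ^+ #|J| * (I_ J == [set 0])%:R : C).
  apply: eq_bigr => J _.
  rewrite -(character_sum_ideal chi_nd) ?local_decomposition_ideal //.
  rewrite mulr_sumr [RHS]big_mkcond; apply: eq_bigr => x _.
  by rewrite mulrCA mulr_natr mulrb; case: ifP; rewrite ?mulr0.
rewrite -negb_forall.
case: (boolP [forall i, _]) => [Ff|nFf]; last first.
  by rewrite big1 // => J _; rewrite local_decomposition_ideal0 (negbTE nFf) mulr0.
rewrite (bigD1 setT) //= local_decomposition_ideal0 Ff eqxx mulr1 cardsT card_ord.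
rewrite big1 ?addr0 // => J /negbTE neqJ.
by rewrite local_decomposition_ideal0 neqJ andbF mulr0.
Qed.

End LocalDecomposition.

(** The value chosen by [epsilon] comes with a decomposition, to which [character_sum_units]
    applies. In the one-element ring the only unit is 0, and [chi 0 = 1]. *)
Lemma mobius_unit_sum (C : fieldType) (T : finComPzRingType) (chi : T -> C) :
  (exists m, is_mobius T m) -> nondegenerate_character chi ->
  \sum_(u : T | ring_unit u) chi u = (mobius T)%:~R.
Proof.
move=> ex_m chi_nd; have : is_mobius T (mobius T) by exact: epsilon_spec.
case=> d [T_ [f [f_dec ->]]].
case: eqP => [T1|_]; last first.
  by rewrite (character_sum_units f_dec chi_nd); case: ifP => //; rewrite rmorphXn rmorphN1.
have T0 x : x = 0 :> T by apply/fintype_le1P; rewrite T1.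
rewrite (big_pred1 0) => [|x]; first by case: chi_nd => ->.
have -> : x = 1 by rewrite [x]T0 [1]T0.
by rewrite ring_unit1 /= [1]T0 eqxx.
Qed.

(** * Local decomposition from primitive idempotents *)

(** The nonunits are then exactly the nilpotent elements, which are closed under addition by the
    binomial theorem. *)
Lemma is_local_nilpotent_or_unit (T : finComPzRingType) :
  1 != 0 :> T -> (forall a : T, ring_unit a \/ exists m, a ^+ m = 0) ->
  is_local T.
Proof.
move=> T_neq0 nil_or_unit.
have nilN m (a : T) : a ^+ m = 0 -> ~~ ring_unit a.
  move=> am; apply: contra T_neq0 => /ring_unitP[b ba].
  by rewrite -(expr1n _ m) -ba exprMn am mulr0.
apply/is_localE/is_idealP; split.
- by rewrite inE (@nilN 1%N).
- move=> x y; rewrite !inE.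
  case: (nil_or_unit x) => [->//|[m xm]]; case: (nil_or_unit y) => [->//|[l yl]].
  move=> _ _; apply: (@nilN (m + l)%N); rewrite exprDn big1 // => i _.
  have [le_li | /ltnW lt_il] := leqP l i.
    by rewrite -(subnKC le_li) exprD yl mul0r mulr0 mul0rn.
  by rewrite -addnBA // exprD xm !mul0r mul0rn.
- by move=> a x; rewrite !inE ring_unitM negb_and => ->; rewrite orbT.
Qed.

HB.instance Definition _ n (R : finZmodAlgType n) (x : R) :=
  GRing.isNmodMorphism.Build R (quotAnn x) (quotAnn_pi x)
    (conj (quotAnn_pi0 x) (quotAnn_piD x)).

HB.instance Definition _ n (R : finZmodAlgType n) (x : R) :=
  GRing.isMonoidMorphism.Build R (quotAnn x) (quotAnn_pi x)
    (conj erefl (quotAnn_piM x)).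

Lemma quotAnn_eq n (R : finZmodAlgType n) (x a b : R) :
  quotAnn_pi x a = quotAnn_pi x b <-> a * x = b * x.
Proof. by split=> [/eqP/quotAnn_piP|/quotAnn_piP/eqP]. Qed.

Section PrimitiveIdempotents.
Variables (n : nat) (T : finZmodAlgType n).
Implicit Types e g : T.

Definition is_idempotent e := e * e == e.

Definition primitive_idempotents : {set T} :=
  [set e | [&& is_idempotent e, e != 0
    & [forall g, is_idempotent g ==> ((e * g == 0) || (e * g == e))]]].

Lemma primitive_idempotentP e :
  reflect [/\ e * e = e, e != 0
            & forall g, g * g = g -> e * g = 0 \/ e * g = e]
          (e \in primitive_idempotents).
Proof.
rewrite inE; apply: (iffP and3P) => [] [/eqP ee e0 min_e]; split=> //.
- move=> g /eqP gg; have := implyP (forallP min_e g) gg.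
  by case/orP=> /eqP; [left | right].
- apply/forallP=> g; apply/implyP=> /eqP /min_e[] ->; rewrite eqxx ?orbT //.
Qed.

Lemma primitive_idempotents_orthogonal :
  {in primitive_idempotents &, forall e e', e != e' -> e * e' = 0}.
Proof.
move=> e e' /primitive_idempotentP[ee _ min_e] /primitive_idempotentP[e'e' _ min_e'].
have [//|ee'] := min_e _ e'e'.
have [<-|e'e] := min_e' _ ee; first by rewrite mulrC.
by rewrite -ee' mulrC e'e eqxx.
Qed.

(** Among the nonzero idempotents below [e], take g generating an ideal of least size. If gh is
    nonzero for an idempotent h, it generates the same ideal, so g is a multiple of gh and is fixed
    by h. *)
Lemma exists_primitive_idempotent e :
  e * e = e -> e != 0 -> exists2 g, g \in primitive_idempotents & g * e = g.
Proof.
move=> ee e0; pose P g := [&& is_idempotent g, g != 0 & g * e == g].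
have Pe : P e by rewrite /P /is_idempotent ee eqxx e0.
case: (arg_minnP (fun g => #|principal_ideal g|) Pe) => g /and3P[/eqP gg g0 /eqP ge] min_g.
exists g => //; apply/primitive_idempotentP; split=> // h hh.
have [|gh0] := eqVneq (g * h) 0; [by left | right].
have sub_gh : principal_ideal (g * h) \subset principal_ideal g.
  apply/subsetP=> _ /imsetP[a _ ->]; rewrite [g * h]mulrC mulrA.
  exact: imset_f.
have eq_gh : principal_ideal (g * h) = principal_ideal g.
  apply/eqP; rewrite eqEcard sub_gh; apply: min_g; rewrite /P /is_idempotent gh0.
  by rewrite mulrACA gg hh eqxx mulrAC ge eqxx.
have := mem_principal_ideal g; rewrite -eq_gh => /imsetP[a _ gE].
by rewrite {1}gE -!mulrA hh -gE.
Qed.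

(** The sum s is an idempotent fixing every primitive idempotent. Were 1 - s nonzero, a primitive
    idempotent below it would be both fixed and killed by 1 - s. *)
Lemma sum_primitive_idempotents : \sum_(e in primitive_idempotents) e = 1.
Proof.
set s := \sum_(e in _) e.
have esE e : e \in primitive_idempotents -> e * s = e.
  move=> eE; rewrite mulr_sumr (bigD1 e) //= big1 ?addr0 => [|e' /andP[e'E neq]].
    by case/primitive_idempotentP: eE.
  by rewrite primitive_idempotents_orthogonal // eq_sym.
have ss : s * s = s.
  by rewrite {1}/s mulr_suml; apply: eq_bigr => e; exact: esE.
have idem1s : (1 - s) * (1 - s) = 1 - s.
  by rewrite mulrBl mul1r mulrBr mulr1 ss subrr subr0.
apply/esym/eqP; rewrite -subr_eq0; apply: contraT => /(exists_primitive_idempotent idem1s).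
case=> g gE; rewrite mulrBr mulr1 esE // subrr => g0.
by case/primitive_idempotentP: gE; rewrite -g0 eqxx.
Qed.

(** The quotient is the factor Te. Some power of a is an idempotent f, and primitivity gives ef = 0
    or ef = e: in the quotient a is nilpotent or a unit. *)
Lemma quotAnn_primitive_local e :
  e \in primitive_idempotents -> is_local (quotAnn e).
Proof.
case/primitive_idempotentP=> ee e0 min_e.
apply: is_local_nilpotent_or_unit => [|u].
  rewrite -quotAnn_pi0 -[1]/(quotAnn_pi e 1).
  by apply: contra e0 => /quotAnn_piP; rewrite mul1r mul0r => ->.
have [a ->] := quotAnn_surj u.
have [[//|N] _ idem] := exists_idempotent_power a.
have [eaN|eaN] := min_e _ idem; [right | left].
  by exists N.+1; rewrite -rmorphXn -[RHS](rmorph0 (quotAnn_pi e)); apply/quotAnn_eq; rewrite mul0r mulrC.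
apply/ring_unitP; exists (quotAnn_pi e (a ^+ N)).
by rewrite -rmorphM -exprSr -[RHS](rmorph1 (quotAnn_pi e)); apply/quotAnn_eq; rewrite mul1r mulrC.
Qed.

Lemma exists_mobius : exists m, is_mobius T m.
Proof.
pose e (i : 'I_#|primitive_idempotents|) := enum_val i.
have eP i : e i \in primitive_idempotents by exact: enum_valP.
have sum_e : \sum_i e i = 1.
  by rewrite -sum_primitive_idempotents [RHS]big_enum_val.
suff dec : local_decomposition (fun i => quotAnn_pi (e i) : {rmorphism T -> quotAnn (e i)}).
  eexists; exists #|primitive_idempotents|, (fun i => quotAnn (e i) : finComPzRingType).
  by exists (fun i => quotAnn_pi (e i) : {rmorphism T -> quotAnn (e i)}); split.
split=> [i|y]; first exact: quotAnn_primitive_local.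
have inj_e (x x' : T) : (forall i, x * e i = x' * e i) -> x = x'.
  move=> eq_x; rewrite -[x]mulr1 -[x']mulr1 -sum_e !mulr_sumr.
  exact: eq_bigr.
(* By orthogonality, the j-th term has coordinate [y j] at j and 0 at every other index. *)
have fx i : quotAnn_pi (e i) (\sum_j repr (y j) * e j) = y i.
  rewrite -[RHS]quotAnn_repr; apply/quotAnn_eq.
  rewrite mulr_suml (bigD1 i) //= big1 ?addr0 => [|j neq_ji]; rewrite -mulrA.
    by case/primitive_idempotentP: (eP i) => ->.
  rewrite (primitive_idempotents_orthogonal (eP j) (eP i)) ?mulr0 //.
  by rewrite (inj_eq enum_val_inj).
exists (\sum_j repr (y j) * e j); split=> // x' fx'.
by apply: inj_e => i; apply/quotAnn_eq; rewrite fx; exact: esym (fx' i).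
Qed.

End PrimitiveIdempotents.

(** * Characters from linear functionals *)

Section RootOfUnityCharacter.
Variables (C : fieldType) (n : nat) (zeta : C).
Hypotheses (n_gt0 : (0 < n)%N) (zeta_prim : n.-primitive_root zeta).

Lemma Zmod_character_morph :
  {morph (fun c : Zmod n => zeta ^+ Zmod_val c) : c d / c + d >-> c * d}.
Proof.
move=> c d.
rewrite -[Zmod_val (c + d)]/((Zmod_val c + Zmod_val d) %% n.-1.+1)%N prednK //.
by rewrite prim_expr_mod // exprD.
Qed.

Lemma Zmod_character_eq1 (c : Zmod n) : (zeta ^+ Zmod_val c == 1) = (c == 0).
Proof.
have lt_cn : (Zmod_val c < n)%N.
  by rewrite -[X in (_ < X)%N](prednK n_gt0); exact: (ltn_ord (c : 'I_n.-1.+1)).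
by rewrite -(prim_order_dvd zeta_prim) /dvdn modn_small.
Qed.

(** Powers of a primitive root are faithful on Z/n, so a character trivial on an ideal means that
    [psi] vanishes there. *)
Lemma functional_character (T : finZmodAlgType n) (psi : T -> Zmod n) :
  nondegenerate_functional psi ->
  nondegenerate_character (fun a => zeta ^+ Zmod_val (psi a)).
Proof.
case=> lin nd.
have psiD : {morph psi : x y / x + y}.
  by move=> x y; have := lin 1 x y; rewrite /Zmod_scale rmorph1 !mul1r.
have psi0 : psi 0 = 0 by apply: (addIr (psi 0)); rewrite -psiD !add0r.
split=> [|a b|I idI chiI]; first by rewrite psi0.
- by rewrite psiD Zmod_character_morph.
- by apply: nd => // a aI; apply/eqP; rewrite -Zmod_character_eq1; apply/eqP/chiI.
Qed.

End RootOfUnityCharacter.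

(** * Explicit evaluation of Ramanujan sums *)

Section QuotientMap.
Variables (n : nat) (R : finZmodAlgType n) (g x : R).

(** The canonical projection, available because Ann(x) is contained in Ann(gx). *)
Definition quotAnn_map (u : quotAnn x) : quotAnn (g * x) :=
  quotAnn_pi (g * x) (repr u).

Lemma quotAnn_mapE a : quotAnn_map (quotAnn_pi x a) = quotAnn_pi (g * x) a.
Proof.
by apply/quotAnn_eq; rewrite mulrCA repr_quotAnn_pi mulrCA.
Qed.

Lemma quotAnn_map_surj w : exists u, quotAnn_map u = w.
Proof.
by exists (quotAnn_pi x (repr w)); rewrite quotAnn_mapE quotAnn_repr.
Qed.

Lemma quotAnn_map_nmod_morphism : nmod_morphism quotAnn_map.
Proof.
split=> [|u v]; first by rewrite -quotAnn_pi0 quotAnn_mapE quotAnn_pi0.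
have [[a ->] [b ->]] := (quotAnn_surj u, quotAnn_surj v).
by rewrite -rmorphD !quotAnn_mapE rmorphD.
Qed.

Lemma quotAnn_map_monoid_morphism : monoid_morphism quotAnn_map.
Proof.
split=> [|u v]; first by rewrite -[1 in LHS](rmorph1 (quotAnn_pi x)) quotAnn_mapE.
have [[a ->] [b ->]] := (quotAnn_surj u, quotAnn_surj v).
by rewrite -rmorphM !quotAnn_mapE rmorphM.
Qed.

HB.instance Definition _ := GRing.isNmodMorphism.Build (quotAnn x)
  (quotAnn (g * x)) quotAnn_map quotAnn_map_nmod_morphism.
HB.instance Definition _ := GRing.isMonoidMorphism.Build (quotAnn x)
  (quotAnn (g * x)) quotAnn_map quotAnn_map_monoid_morphism.

End QuotientMap.

Lemma phi_gt0 (T : finComPzRingType) : (0 < phi T)%N.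
Proof. by apply/card_gt0P; exists 1; rewrite inE ring_unit1. Qed.

(** Since psi_x(ga) = psi(agx) = psi_gx(a), the summand is the pullback of the character [chi] of
    R/Ann(gx). *)
Lemma ramanujan_sum_quotAnnE (C : numClosedFieldType) n (zeta : C)
    (R : finZmodAlgType n) (psi : R -> Zmod n) (g x : R) :
  (0 < n)%N -> n.-primitive_root zeta -> nondegenerate_functional psi ->
  ramanujan_sum_quotAnn zeta psi g x =
    (phi (quotAnn x))%:R / (phi (quotAnn (g * x)))%:R
    * (mobius (quotAnn (g * x)))%:~R.
Proof.
move=> n_gt0 zeta_prim psi_nd.
pose chi (u : quotAnn (g * x)) : C := zeta ^+ Zmod_val (quotAnn_psi psi u).
have chi_nd : nondegenerate_character chi.
  by apply: functional_character => //; exact: quotAnn_psi_nondegenerate.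
rewrite -(mobius_unit_sum (exists_mobius _) chi_nd) mulrAC.
have phi0 : (phi (quotAnn (g * x)))%:R != 0 :> C.
  by rewrite Num.Theory.pnatr_eq0 -lt0n phi_gt0.
apply: (mulfI phi0); rewrite [RHS]mulrC divfK //.
rewrite -(sum_units_surj (f := quotAnn_map g (x := x) : {rmorphism _ -> _})); last exact: quotAnn_map_surj.
congr (_ * _); apply: eq_bigr => u _; have [a ->] := quotAnn_surj u.
by rewrite /chi /= quotAnn_mapE -quotAnn_piM !quotAnn_psiE mulrCA mulrA.
Qed.

(** * Generators of a principal ideal *)

(** Multiplication by [x] identifies R/Ann(x) with Rx. If s = ax and x = bs, then bax = x, so a is
    invertible modulo Ann(x); the converse is similar. *)
Lemma sum_principal_generators (V : nmodType) n (R : finZmodAlgType n) (x : R)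
    (F : R -> V) :
  \sum_(s | principal_ideal s == principal_ideal x) F s =
  \sum_(u : quotAnn x | ring_unit u) F (repr u * x).
Proof.
pose h (u : quotAnn x) : R := repr u * x.
have h_inj : injective h.
  by move=> u v eq_h; rewrite -[u]quotAnn_repr -[v]quotAnn_repr; exact/quotAnn_eq.
rewrite -(big_imset F (h := h) (A := [pred u | ring_unit u])) => [|u v _ _]; last exact: h_inj.
apply: eq_bigl => s; apply/eqP/imsetP=> [sx|[u /ring_unitP[v vu] ->]].
  have := mem_principal_ideal s; rewrite sx => /imsetP[a _ sE].
  exists (quotAnn_pi x a); last by rewrite /h repr_quotAnn_pi.
  have := mem_principal_ideal x; rewrite -sx => /imsetP[b _ xE].
  apply/ring_unitP; exists (quotAnn_pi x b).
  rewrite -rmorphM -[RHS](rmorph1 (quotAnn_pi x)); apply/quotAnn_eq.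
  by rewrite mul1r -mulrA -sE -xE.
have [b vE] := quotAnn_surj v.
have bux : b * (repr u * x) = x.
  rewrite mulrA -[RHS]mul1r; apply/(quotAnn_eq x).
  by rewrite quotAnn_piM quotAnn_repr -vE vu.
apply/setP=> t; apply/imsetP/imsetP=> [] [a _ ->].
  by exists (a * repr u); rewrite // mulrA.
by exists (a * b); rewrite // -mulrA bux.
Qed.

Lemma principal_idealN (R : finComPzRingType) (x : R) :
  principal_ideal (- x) = principal_ideal x.
Proof.
by apply/setP=> t; apply/imsetP/imsetP=> [] [a _ ->];
  exists (- a); rewrite // ?mulNr ?mulrN ?opprK.
Qed.

(** * Diagonalisation of the adjacency matrix *)

(** Take determinants over the polynomial ring in (X - A)F = F(X - diag d) and cancel det F. *)
Lemma char_poly_diagonalized (C : fieldType) m (A F : 'M[C]_m) (d : 'rV_m) :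
  F \in unitmx -> A *m F = F *m diag_mx d ->
  char_poly A = \prod_i ('X - (d 0 i)%:P).
Proof.
move=> F_unit AF; have detF0 : \det (map_mx polyC F) != 0.
  by rewrite det_map_mx polyC_eq0 -unitfE.
have -> : \prod_i ('X - (d 0 i)%:P) = char_poly (diag_mx d).
  rewrite char_poly_trig ?diag_mx_is_trig //.
  by apply: eq_bigr => i _; rewrite mxE eqxx.
apply: (mulIf detF0); rewrite [RHS]mulrC /char_poly -!det_mulmx; congr (\det _).
rewrite /char_poly_mx mulmxBl mulmxBr -!map_mxM AF; congr (_ - _).
by rewrite scalar_mxC.
Qed.

Lemma spectrum_diagonalized (C : closedFieldType) m (A F : 'M[C]_m) (d : 'rV_m) :
  F \in unitmx -> A *m F = F *m diag_mx d ->
  perm_eq (spectrum A) [seq d 0 i | i : 'I_m].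
Proof.
move=> F_unit AF; apply: prod_XsubC_eq; rewrite /spectrum.
case: closed_field_poly_normal => s /= sE.
rewrite big_image -(char_poly_diagonalized F_unit AF) sE.
by rewrite (monicP (char_poly_monic A)) scale1r.
Qed.

Section GcdGraphSpectrum.
Variables (C : closedFieldType) (R : finComPzRingType) (chi : R -> C).
Hypotheses (chi_nd : nondegenerate_character chi) (R_neq0 : #|R|%:R != 0 :> C).

Lemma gcd_graph_spectrum (D : {set {set R}}) :
  perm_eq (spectrum (adjacency_mx C (gcd_graph D)))
    [seq \sum_(s | principal_ideal s \in D) chi (g * s) | g : R].
Proof.
pose lam g := \sum_(s | principal_ideal s \in D) chi (g * s).
have [chi0 chiD _] := chi_nd.
(* [F] is the character table, whose columns are the eigenvectors; by orthogonality [F *m G] is the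
   scalar matrix of [#|R|]. *)
pose F : 'M[C]_#|R| := \matrix_(i, j) chi (enum_val i * enum_val j).
pose G : 'M[C]_#|R| := \matrix_(i, j) chi (- enum_val i * enum_val j).
have F_unit : F \in unitmx.
  suff /mulmx1_unit[] : F *m (#|R|%:R^-1 *: G) = 1%:M by [].
  rewrite -scalemxAr; apply/matrixP=> i j; rewrite !mxE.
  under eq_bigr => k _ do rewrite !mxE mulNr mulrC [enum_val k * _]mulrC -mulNr -chiD -mulrDl.
  rewrite -(big_enum_val (A := R) (fun a => chi ((_ + _) * a))) /=.
  rewrite (character_sum chi_nd) mulKf // addrC subr_eq0.
  by rewrite (inj_eq enum_val_inj).
pose d : 'rV[C]_#|R| := \row_i lam (enum_val i).
have AF : adjacency_mx C (gcd_graph D) *m F = F *m diag_mx d.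
  apply/matrixP=> i j; rewrite mul_mx_diag !mxE.
  under eq_bigr => k _ do rewrite !mxE.
  rewrite -(big_enum_val (A := R)
    (fun a => (gcd_graph D (enum_val i) a)%:R * chi (a * enum_val j))) /=.
  (* The neighbours of a vertex are its translates by the s with Rs in [D]; the difference of the
     endpoints is -s, which generates the same ideal. *)
  rewrite (reindex_inj (addrI (enum_val i))) /lam mulr_sumr [RHS]big_mkcond.
  apply: eq_bigr => s _; rewrite /gcd_graph opprD addNKr principal_idealN.
  by case: ifP => _; rewrite ?mul0r // mul1r mulrDl chiD [s * _]mulrC.
apply: (perm_trans (spectrum_diagonalized F_unit AF)).
apply: prod_XsubC_eq; rewrite !big_image /= [RHS]big_enum_val.
by apply: eq_bigr => i _; rewrite mxE.
Qed.

End GcdGraphSpectrum.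

(** * Eigenvalues as sums of Ramanujan sums *)

Theorem theorem4p16
  (K : realType) (n : nat) (n_gt0 : (0 < n)%N)
  (zeta : K[i]) (zeta_prim : n.-primitive_root zeta)
  (R : finZmodAlgType n) 
  (psi : R -> Zmod n) (psi_nd : nondegenerate_functional psi)
  (k : nat) (x_ : 'I_k -> R) (I_ : 'I_k -> {set R})
  (I_inj : injective I_)
  (I_neq0 : forall i, I_ i <> [set 0])
  (I_principal : forall i, I_ i = principal_ideal (x_ i)) :
  let D := [set I_ i | i : 'I_k] in
  let lambda (g : R) : K[i] :=
    \sum_(i < k) ramanujan_sum_quotAnn zeta psi g (x_ i) in
  perm_eq (spectrum (adjacency_mx K[i] (gcd_graph D))) [seq lambda g | g : R]
  /\
  forall (g : R) (i : 'I_k),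
    ramanujan_sum_quotAnn zeta psi g (x_ i) =
      (phi (quotAnn (x_ i)))%:R / (phi (quotAnn (g * x_ i)))%:R
      * (mobius (quotAnn (g * x_ i)))%:~R.
Proof.
have chi_nd := functional_character n_gt0 zeta_prim psi_nd.
split=> [|g i]; last exact: ramanujan_sum_quotAnnE.
have R_neq0 : #|R|%:R != 0 :> K[i].
  by rewrite Num.Theory.pnatr_eq0 -lt0n; apply/card_gt0P; exists 0.
apply: (perm_trans (gcd_graph_spectrum chi_nd R_neq0 _)).
have -> // : [seq \sum_(s | principal_ideal s \in [set I_ i | i : 'I_k])
    zeta ^+ Zmod_val (psi (g * s)) | g : R] =
  [seq \sum_(i < k) ramanujan_sum_quotAnn zeta psi g (x_ i) | g : R].
apply: eq_image => // g.
rewrite (eq_bigl (fun s => [exists i, principal_ideal s == I_ i])) => [|s]; last first.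
  by apply/imsetP/existsP=> [[i _ ->]|[i /eqP ->]]; exists i.
(* The ideals are distinct, so each s generates at most one of them and the sum splits by index. *)
transitivity (\sum_(i < k) \sum_(s | principal_ideal s == I_ i)
    zeta ^+ Zmod_val (psi (g * s))); last first.
  apply: eq_bigr => i _; rewrite I_principal sum_principal_generators.
  apply: eq_bigr => u _; congr (_ ^+ Zmod_val _).
  by rewrite -[u in RHS]quotAnn_repr -quotAnn_piM quotAnn_psiE mulrA.
rewrite big_mkcond.
under [RHS]eq_bigr do rewrite big_mkcond.
rewrite [RHS]exchange_big; apply: eq_bigr => s _.
case: existsP => [[i /eqP sI]|nsI].
  rewrite (bigD1 i) //= sI eqxx big1 ?addr0 // => j neq_ji.
  by rewrite (inj_eq I_inj) eq_sym (negbTE neq_ji).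
by rewrite big1 // => i _; case: eqP => // sI; case: nsI; exists i; apply/eqP.
Qed.
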